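(* Let $F$ be an arbitrary field and let $P$ and $P'$ be Dedekind Poisson algebras over $F$ given in the canonical forms of type (I) or type (II) described in the context. Isomorphisms are $F$-linear bijections preserving both multiplications. (1) If $P=E\oplus Z$ and $P'=E'\oplus Z'$ are both of type (I), then $P\cong P'$ if and only if ($E=0\Longleftrightarrow E'=0$) and $\dim_F Z=\dim_F Z'$. (2) If $P=P(E,Z,V,c,\beta,\omega)$ and $P'=P(E',Z',V',c',\beta',\omega')$ are both of type (II), then $P\cong P'$ if and only if ($E=0\Longleftrightarrow E'=0$), $\dim_F Z=\dim_F Z'$, and the pairs $(\beta,\omega)$ and $(\beta',\omega')$ are simultaneously similar, i.e. there exist a vector-space isomorphism $\varphi:V\to V'$ and a scalar $\lambda\in F^\times$ such that $$\beta'(\varphi u,\varphi v)=\lambda\beta(u,v),\qquad \omega'(\varphi u,\varphi v)=\lambda\omega(u,v)\qquad\text{for all }u,v\in V.$$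
   Context: A Poisson algebra over a field $F$ is an $F$-vector space $P$ with a bilinear commutative associative multiplication $xy$ (no identity element is assumed) and an alternating Lie bracket $[\,,\,]$ ($[x,x]=0$ for all $x$) satisfying $[xy,z]=x[y,z]+y[x,z]$. A Poisson subalgebra is a subspace closed under both operations; a Poisson ideal is a subspace $I$ with $PI\subseteq I$ and $[P,I]\subseteq I$. A Poisson algebra is Dedekind if every Poisson subalgebra is a Poisson ideal. No finite-dimensionality is assumed; dimensions are cardinals. Canonical forms (all products and brackets not displayed or forced by bilinearity, commutativity and alternation are zero): Type (I): $P=E\oplus Z$ (direct sum of vector spaces), where both multiplications vanish on $Z$, either $E=0$ or $E=Fe$ with $e\ne0$, $e^2=e$; $eZ=0$ and all Lie brackets are zero. Type (II): $P=P(E,Z,V,c,\beta,\omega)=E\oplus Z\oplus V\oplus Fc$ (direct sum of vector spaces), with $V\neq0$, $c\neq0$, either $E=0$ or $E=Fe$ with $e\neq0$, $e^2=e$; $\beta:V\times V\to F$ is a symmetric bilinear form with $\beta(v,v)\neq0$ for every $0\neq v\in V$, $\omega:V\times V\to F$ is an alternating bilinear form ($\omega(v,v)=0$ for all $v$), and the only possibly non-zero operations besides $e^2=e$ are $uv=\beta(u,v)c$ and $[u,v]=\omega(u,v)c$ for $u,v\in V$. *)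

(* Defs.v *)
From HB Require Import structures.
From mathcomp Require Import all_boot all_algebra.
From mathcomp Require Import boolp classical_sets functions cardinality.

Set Implicit Arguments.
Unset Strict Implicit.
Unset Printing Implicit Defensive.

Import GRing.Theory.
Local Open Scope ring_scope.

HB.mixin Record isPoisson (F : fieldType) P of GRing.Lmodule F P := {
  pmul : {bilinear P -> P -> P | *:%R & *:%R};
  pbr : {bilinear P -> P -> P | *:%R & *:%R};
  pmulA : forall x y z : P, pmul x (pmul y z) = pmul (pmul x y) z;
  pmulC : forall x y : P, pmul x y = pmul y x;
  pbrxx : forall x : P, pbr x x = 0;
  pbr_jacobi : forall x y z : P,
    pbr x (pbr y z) + pbr y (pbr z x) + pbr z (pbr x y) = 0;
  pbr_leibniz : forall x y z : P,
    pbr (pmul x y) z = pmul x (pbr y z) + pmul y (pbr x z)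
}.

#[short(type="poissonType")]
HB.structure Definition Poisson (F : fieldType) :=
  { P of GRing.Lmodule F P & isPoisson F P }.

Definition poisson_subalgebra (F : fieldType) (P : poissonType F)
    (S : submodClosed P) : Prop :=
  forall x y : P, x \in S -> y \in S -> pmul x y \in S /\ pbr x y \in S.

Definition poisson_ideal (F : fieldType) (P : poissonType F)
    (I : submodClosed P) : Prop :=
  forall x y : P, y \in I -> pmul x y \in I /\ pbr x y \in I.

Definition dedekind (F : fieldType) (P : poissonType F) : Prop :=
  forall S : submodClosed P, poisson_subalgebra S -> poisson_ideal S.

Definition poisson_isomorphic (F : fieldType) (P P' : poissonType F) : Prop :=
  exists f : {linear P -> P'},
    [/\ bijective f,
        forall x y, f (pmul x y) = pmul (f x) (f y)
      & forall x y, f (pbr x y) = pbr (f x) (f y)].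

(* The subspace W, viewed as a vector space in its own right. *)
Section SubspaceType.
Variables (F : fieldType) (U : lmodType F) (W : submodClosed U).

Record subspace := Subspace { subspace_val : U; _ : subspace_val \in W }.

HB.instance Definition _ := [isSub for subspace_val].
HB.instance Definition _ := [Choice of subspace by <:].
HB.instance Definition _ := [SubChoice_isSubLmodule of subspace by <:].
End SubspaceType.

Definition is_zero_subspace (F : fieldType) (U : lmodType F)
    (W : submodClosed U) : Prop :=
  forall x : U, x \in W <-> x = 0.

Definition linearly_independent (F : fieldType) (U : lmodType F)
    (B : set U) : Prop :=
  forall (s : seq U) (a : U -> F), uniq s -> (forall u, u \in s -> B u) ->
    \sum_(u <- s) a u *: u = 0 -> forall u, u \in s -> a u = 0.

Definition spanning (F : fieldType) (U : lmodType F) (B : set U) : Prop :=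
  forall x : U, exists (s : seq U) (a : U -> F),
    (forall u, u \in s -> B u) /\ x = \sum_(u <- s) a u *: u.

Definition is_basis (F : fieldType) (U : lmodType F) (B : set U) : Prop :=
  linearly_independent B /\ spanning B.

(* Equality of dimensions as cardinals: bases exist, and any two bases of a
   vector space are equipotent, so one pair of bases determines it. *)
Definition same_dim (F : fieldType) (U U' : lmodType F) : Prop :=
  exists (B : set U) (B' : set U'),
    [/\ is_basis B, is_basis B' & (B #= B')%card].

Definition zero_or_idempotent_line (F : fieldType) (P : poissonType F)
    (E : submodClosed P) : Prop :=
  is_zero_subspace E \/
  exists e : P, [/\ e != 0, pmul e e = e
                  & forall x : P, x \in E <-> exists a : F, x = a *: e].

Record typeI (F : fieldType) (P : poissonType F) (E Z : submodClosed P) :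
    Prop := TypeI {
  typeI_sum : forall x : P, exists y z : P,
    [/\ y \in E, z \in Z & x = y + z];
  typeI_direct : forall y z : P, y \in E -> z \in Z ->
    y + z = 0 -> y = 0 /\ z = 0;
  typeI_E : zero_or_idempotent_line E;
  typeI_mulZZ : forall z z' : P, z \in Z -> z' \in Z -> pmul z z' = 0;
  typeI_mulEZ : forall y z : P, y \in E -> z \in Z -> pmul y z = 0;
  typeI_br : forall x y : P, pbr x y = 0
}.

Record typeII (F : fieldType) (P : poissonType F) (E Z V : submodClosed P)
    (c : P) (beta omega : {biscalar (subspace V)}) : Prop := TypeII {
  typeII_sum : forall x : P, exists (y z v : P) (t : F),
    [/\ y \in E, z \in Z, v \in V & x = y + z + v + t *: c];
  typeII_direct : forall (y z v : P) (t : F), y \in E -> z \in Z -> v \in V ->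
    y + z + v + t *: c = 0 -> [/\ y = 0, z = 0, v = 0 & t *: c = 0];
  typeII_V : ~ is_zero_subspace V;
  typeII_c : c != 0;
  typeII_E : zero_or_idempotent_line E;
  typeII_beta_sym : forall u v, beta u v = beta v u;
  typeII_beta_aniso : forall v, v != 0 -> beta v v != 0;
  typeII_omega_alt : forall v, omega v v = 0;
  typeII_mulVV : forall u v : subspace V,
    pmul (val u) (val v) = beta u v *: c;
  typeII_brVV : forall u v : subspace V,
    pbr (val u) (val v) = omega u v *: c;
  typeII_mulZ : forall z x : P, z \in Z -> pmul z x = 0;
  typeII_mulc : forall x : P, pmul c x = 0;
  typeII_mulEV : forall y v : P, y \in E -> v \in V -> pmul y v = 0;
  typeII_brE : forall y x : P, y \in E -> pbr y x = 0;
  typeII_brZ : forall z x : P, z \in Z -> pbr z x = 0;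
  typeII_brc : forall x : P, pbr c x = 0
}.

Definition simultaneously_similar (F : fieldType) (V V' : lmodType F)
    (beta omega : {biscalar V}) (beta' omega' : {biscalar V'}) : Prop :=
  exists (phi : {linear V -> V'}) (lambda : F),
    [/\ bijective phi, lambda != 0,
        forall u v, beta' (phi u) (phi v) = lambda * beta u v
      & forall u v, omega' (phi u) (phi v) = lambda * omega u v].

(* Main.v *)
Require Import Defs.
From HB Require Import structures.
From mathcomp Require Import all_boot all_algebra.
From mathcomp Require Import boolp classical_sets functions cardinality.

Set Implicit Arguments.
Unset Strict Implicit.
Unset Printing Implicit Defensive.

(** The invariants in the theorem are read off from constructions that every
    isomorphism preserves, and conversely they rebuild the algebra.

    Let Ann be the set of elements killed by all products and all brackets.
    In type (I) Ann is Z, so an isomorphism carries Z onto Z'.  In type (II)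
    Ann = Z + Fc, and anisotropy of beta identifies Ann + V as the set of x
    with x^2 in Ann.  In both types E = 0 says that 0 is the only idempotent.
    Let f be an isomorphism of algebras of type (II).  Both operations factor
    through the quotient by Ann, so f induces a bijection phi : V -> V' which
    sends v to the v' with f v - v' in Ann'.  Applying f to
    v^2 = beta(v,v) c for some v <> 0 shows f c = lambda c'.  Comparing
    f(uv) and f([u,v]) with phi(u) phi(v) and [phi u, phi v] then gives the
    similarity with this same lambda, and Z = Ann / Fc is isomorphic to
    Ann' / Fc' = Z'.  These steps are [typeII_annihilator],
    [typeII_square_annihilator], [typeII_isomorphism_mod_annihilator] and
    [typeII_isomorphism_line].

    Conversely the maps e |-> e', Z -> Z', phi and c |-> lambda c' add up to
    a linear bijection, which preserves both operations by the explicit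
    formulas [typeI_pmul] and [typeII_operations].

    All linear bijections here are obtained from their graphs by
    [linear_bijection_of_graph], so that no projection onto a summand has to
    be constructed.  Dimensions enter through the equivalence between
    equality of dimensions and existence of a linear bijection, which in one
    direction needs a basis of an arbitrary space, hence Zorn's lemma. *)

Import GRing.Theory.
Local Open Scope ring_scope.

(** * Linear bijections and their graphs *)

Definition linear_graph (F : fieldType) (U W : lmodType F)
    (R : U -> W -> Prop) : Prop :=
  forall a x y x' y', R x y -> R x' y' -> R (a *: x + x') (a *: y + y').

Lemma linear_graph_sub (F : fieldType) (U W : lmodType F) (R : U -> W -> Prop)
    x y x' y' :
  linear_graph R -> R x y -> R x' y' -> R (x - x') (y - y').
Proof.
by move=> linR Rxy Rxy'; have := linR (-1) _ _ _ _ Rxy' Rxy;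
   rewrite !scaleN1r ![- _ + _]addrC.
Qed.

(** By linearity, the kernel conditions say that the relation is functional
    in both directions; choice then turns it into a function. *)
Lemma linear_bijection_of_graph (F : fieldType) (U W : lmodType F)
    (R : U -> W -> Prop) :
    linear_graph R ->
    (forall x, exists y, R x y) -> (forall y, exists x, R x y) ->
    (forall y, R 0 y -> y = 0) -> (forall x, R x 0 -> x = 0) ->
  exists f : {linear U -> W}, bijective f /\ forall x y, R x y <-> y = f x.
Proof.
move=> linR totl totr R0y Rx0.
have [f Rf] := choice totl; have [g Rg] := choice totr.
have Ruy x y : R x y -> y = f x.
  move=> Rxy; apply/subr0_eq/R0y.
  by rewrite -(subrr x); apply: linear_graph_sub.
have Rux x y : R x y -> x = g y.
  move=> Rxy; apply/subr0_eq/Rx0.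
  by rewrite -(subrr y); apply: linear_graph_sub.
have linf : linear f by move=> a x y; apply/esym/Ruy/linR.
pose fM := GRing.isLinear.Build F U W *:%R f linf.
pose fL : {linear U -> W} := HB.pack f fM.
exists fL; split; last by move=> x y; split=> [/Ruy|->]; rewrite //; exact: Rf.
by exists g => x; [apply/esym/Rux/Rf | apply/esym/Ruy/Rg].
Qed.

(** * Dimension and linear bijections *)

(** A linear relation among elements of an independent family holds formally:
    once repeated entries are collected all coefficients vanish, so the
    relation survives replacing each [u] by an arbitrary [h u].  Formal
    combinations are lists of coefficient-vector pairs, possibly with
    repetitions, because such lists are closed under concatenation. *)
Lemma relation_transfer (F : fieldType) (U W : lmodType F) (B : set U)
    (h : U -> W) (s : seq (F * U)) :
    linearly_independent B -> (forall p, p \in s -> B p.2) ->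
  \sum_(p <- s) p.1 *: p.2 = 0 -> \sum_(p <- s) p.1 *: h p.2 = 0.
Proof.
move=> indB sB s0.
pose coef u := \sum_(p <- s | p.2 == u) p.1.
pose us := undup [seq p.2 | p <- s].
have collect (L : lmodType F) (k : U -> L) :
    \sum_(p <- s) p.1 *: k p.2 = \sum_(u <- us) coef u *: k u.
  under [RHS]eq_bigr do rewrite scaler_suml big_mkcond.
  rewrite exchange_big /= big_seq [RHS]big_seq; apply: eq_bigr => p ps.
  rewrite (bigD1_seq p.2) ?undup_uniq ?mem_undup ?map_f //= eqxx.
  by rewrite big1 ?addr0 // => u /negbTE; rewrite eq_sym => ->.
have usB u : u \in us -> B u.
  by rewrite mem_undup => /mapP[p ps ->]; apply: sB.
rewrite collect big_seq big1 // => u uus.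
rewrite (indB us coef) ?scale0r ?undup_uniq //.
by rewrite -(collect U id).
Qed.

(** The graph of the linear extension of a bijection [g] between the bases
    consists of the pairs obtained from one formal combination by evaluating
    it with and without [g]. *)
Lemma same_dim_linear_bijection (F : fieldType) (U W : lmodType F) :
  same_dim U W -> exists f : {linear U -> W}, bijective f.
Proof.
case=> B [C [[indB spanB] [indC spanC] BC]].
have [g [gBC ginj gsurj]] : exists g : U -> W, set_bij B C g.
  pose W0 : pointedType := HB.pack (GRing.Lmodule.sort W) (isPointed.Build W 0).
  exact: elimT (@card_set_bijP U W0 B C) BC.
have [h hP] : exists h : W -> U, forall y, C y -> B (h y) /\ g (h y) = y.
  have /choice[h hP] : forall y, exists x, C y -> B x /\ g x = y.
    move=> y; have [Cy|nCy] := pselect (C y); last by exists 0.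
    by have [x Bx <-] := gsurj _ Cy; exists x.
  by exists h.
have hg x : B x -> h (g x) = x.
  move=> Bx; have [Bh gh] := hP _ (gBC _ Bx).
  by apply: ginj; rewrite ?inE.
pose R x y := exists s : seq (F * U), [/\ forall p, p \in s -> B p.2,
   x = \sum_(p <- s) p.1 *: p.2 & y = \sum_(p <- s) p.1 *: g p.2].
have [|||||f [fbij _]] := @linear_bijection_of_graph F U W R; last by exists f.
- move=> a _ _ _ _ [s [sB -> ->]] [t [tB -> ->]].
  exists ([seq (a * p.1, p.2) | p <- s] ++ t); split.
  + by move=> p; rewrite mem_cat => /orP[/mapP[q qs ->]|] /=; auto.
  + rewrite big_cat big_map scaler_sumr; congr (_ + _).
    by apply: eq_bigr => p _; rewrite scalerA.
  + rewrite big_cat big_map scaler_sumr; congr (_ + _).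
    by apply: eq_bigr => p _; rewrite scalerA.
- move=> x; have [s [a [sB ->]]] := spanB x.
  exists (\sum_(u <- s) a u *: g u), [seq (a u, u) | u <- s].
  split; rewrite ?big_map //.
  by move=> _ /mapP[u us ->]; apply: sB.
- move=> y; have [s [a [sC ->]]] := spanC y.
  exists (\sum_(u <- s) a u *: h u), [seq (a u, h u) | u <- s].
  split; rewrite ?big_map //=.
    by move=> _ /mapP[u us ->] /=; have [] := hP _ (sC _ us).
  rewrite big_seq [RHS]big_seq; apply: eq_bigr => u us.
  by have [_ ->] := hP _ (sC _ us).
- move=> y [s [sB s0 ->]].
  by apply: (relation_transfer g indB sB); rewrite -s0.
- move=> x [s [sB -> s0]].
  have := @relation_transfer F W U C h [seq (p.1, g p.2) | p <- s] indC.
  rewrite !big_map /= -s0 => back.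
  rewrite -[RHS]back //.
    rewrite big_seq [RHS]big_seq; apply: eq_bigr => p ps.
    by rewrite hg //; apply: sB.
  by move=> _ /mapP[p ps ->] /=; apply/gBC/sB.
Qed.

(** A maximal independent family spans, since a vector outside its span could
    be added.  Independence involves finitely many vectors at a time, so it
    passes to unions of chains. *)
Lemma exists_basis (F : fieldType) (U : lmodType F) :
  exists B : set U, is_basis B.
Proof.
have [|B [indB maxB]] := @Zorn_bigcup U (@linearly_independent F U).
  move=> C Cind Ctot s a us sC sum0 u us'.
  suff [X CX sX] : exists2 X, C X & forall v, v \in s -> X v.
    exact: Cind CX s a us sX sum0 u us'.
  have [X CX Xu] := sC _ us'.
  (* A finite subset of the union of a chain lies in one of its members. *)
  elim: s sC {us sum0 us'} => [|v s IHs] sC; first by exists X.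
  have [|Y CY sY] := IHs; first by move=> w ws; apply: sC; rewrite inE ws orbT.
  have [Y' CY' Y'v] := sC v (mem_head _ _).
  have [YY'|Y'Y] := Ctot _ _ CY CY'; [exists Y' | exists Y] => // w;
    by rewrite inE => /orP[/eqP->|/sY]; auto.
exists B; split=> // x; apply: contrapT => xB.
pose B' := (B `|` [set x])%classic.
apply: (maxB B').
  split; first by move=> y; left.
  move=> B'B; apply: xB; exists [:: x], (fun=> 1); split.
    by move=> u; rewrite inE => /eqP->; apply: B'B; right.
  by rewrite big_seq1 scale1r.
move=> s a us sB' sum0.
have sB u : u \in s -> u != x -> B u by move=> /sB'[//|->]; rewrite eqxx.
have [xs|xs] := boolP (x \in s); last first.
  by apply: indB => // u us'; apply: sB; rewrite // (memPn xs).
move: sum0; rewrite (bigD1_seq x) //= -big_filter => sum0.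
have tB u : u \in [seq i <- s | i != x] -> B u.
  by rewrite mem_filter => /andP[ux /sB]; apply.
(* Otherwise dividing the relation by [a x] puts [x] in the span of [B]. *)
have ax : a x = 0.
  apply: contrapT => /eqP ax; apply: xB.
  exists [seq i <- s | i != x], (fun u => - ((a x)^-1 * a u)); split=> //.
  rewrite -[x in LHS](scalerK ax).
  rewrite -[_ *: x](addrK (\sum_(i <- s | i != x) a i *: i)).
  rewrite -[in X in _ *: (X - _)]big_filter sum0 sub0r scalerN scaler_sumr.
  rewrite -sumrN big_filter; apply: eq_bigr => u _.
  by rewrite scalerA scaleNr.
move: sum0; rewrite ax scale0r add0r => sum0 u us'.
have [->//|ux] := eqVneq u x.
by apply: (indB _ a _ tB sum0); rewrite ?filter_uniq // mem_filter ux.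
Qed.

Lemma linear_bijection_same_dim (F : fieldType) (U W : lmodType F)
    (f : {linear U -> W}) :
  bijective f -> same_dim U W.
Proof.
case=> g fK gK; have [B [indB spanB]] := exists_basis U.
exists B, (f @` B)%classic; split=> //.
- split.
    move=> s a us sB sum0 w ws.
    have gB u : u \in map g s -> B u.
      by move=> /mapP[y ys ->]; have [v Bv <-] := sB _ ys; rewrite fK.
    have := indB (map g s) (a \o f) _ gB.
    rewrite (map_inj_uniq (can_inj gK)) => /(_ us).
    rewrite big_map /= => /(_ _ (g w)); rewrite gK; apply; last exact: map_f.
    apply: (can_inj fK); rewrite linear_sum linear0 -[RHS]sum0.
    by apply: eq_bigr => y _; rewrite linearZ /= !gK.
  move=> y; have [s [a [sB gy]]] := spanB (g y).
  exists (map f s), (a \o g); split.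
    by move=> _ /mapP[u us ->]; exists u => //; apply: sB.
  rewrite -[y]gK gy linear_sum big_map; apply: eq_bigr => u _.
  by rewrite linearZ /= fK.
- by rewrite card_eq_sym; apply: inj_card_eq => x y _ _; apply: (can_inj fK).
Qed.

Lemma subspace_valP (F : fieldType) (U : lmodType F) (W : submodClosed U)
    (w : subspace W) : val w \in W.
Proof. exact: valP w. Qed.

(** * Isomorphism invariants of Poisson algebras *)

Lemma poisson_isomorphic_of_graph (F : fieldType) (P P' : poissonType F)
    (R : P -> P' -> Prop) :
    linear_graph R ->
    (forall x, exists y, R x y) -> (forall y, exists x, R x y) ->
    (forall y, R 0 y -> y = 0) -> (forall x, R x 0 -> x = 0) ->
    (forall x x' y y', R x x' -> R y y' ->
       R (pmul x y) (pmul x' y') /\ R (pbr x y) (pbr x' y')) ->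
  poisson_isomorphic P P'.
Proof.
move=> linR totl totr R0y Rx0 Rop.
have [f [fbij fR]] := linear_bijection_of_graph linR totl totr R0y Rx0.
have Rf x : R x (f x) by apply/fR.
exists f; split=> // x y; apply/esym/fR; by have [] := Rop _ _ _ _ (Rf x) (Rf y).
Qed.

Definition annihilator (F : fieldType) (P : poissonType F) (x : P) : Prop :=
  forall y : P, pmul x y = 0 /\ pbr x y = 0.

Lemma pbr_anti (F : fieldType) (P : poissonType F) (x y : P) :
  pbr x y = - pbr y x.
Proof.
apply/eqP; rewrite -addr_eq0; apply/eqP.
have := pbrxx (x + y).
by rewrite linearDl !linearDr !pbrxx add0r addr0.
Qed.

(** Both operations descend to the quotient by the annihilator. *)
Lemma operations_mod_annihilator (F : fieldType) (P : poissonType F)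
    (x x' y y' : P) :
    annihilator (x - x') -> annihilator (y - y') ->
  pmul x y = pmul x' y' /\ pbr x y = pbr x' y'.
Proof.
move=> annx anny.
have [+ +] := annx y; rewrite !linearBl => /subr0_eq-> /subr0_eq->.
rewrite ![_ x' y]pmulC ![_ x' y']pmulC [pbr x' y]pbr_anti [pbr x' y']pbr_anti.
by have [+ +] := anny x'; rewrite !linearBl => /subr0_eq-> /subr0_eq->.
Qed.

Lemma isomorphism_annihilator (F : fieldType) (P P' : poissonType F)
    (f : {linear P -> P'}) :
    bijective f -> (forall x y, f (pmul x y) = pmul (f x) (f y)) ->
    (forall x y, f (pbr x y) = pbr (f x) (f y)) ->
  forall x, annihilator (f x) <-> annihilator x.
Proof.
case=> g fK gK fM fB x; split=> annx y.
  by have [m0 b0] := annx (f y); split; apply: (can_inj fK);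
     rewrite ?fM ?fB ?m0 ?b0 linear0.
by have [m0 b0] := annx (g y); rewrite -[y]gK -fM -fB m0 b0 linear0.
Qed.

(** For the canonical forms this is the intrinsic meaning of E = 0. *)
Definition idempotent_free (F : fieldType) (P : poissonType F) : Prop :=
  forall x : P, pmul x x = x -> x = 0.

Lemma isomorphism_idempotent_free (F : fieldType) (P P' : poissonType F)
    (f : {linear P -> P'}) :
    bijective f -> (forall x y, f (pmul x y) = pmul (f x) (f y)) ->
  idempotent_free P <-> idempotent_free P'.
Proof.
case=> g fK gK fM; split=> free x xx.
  rewrite -[x]gK (free (g x)) ?linear0 //.
  by apply: (can_inj fK); rewrite fM gK.
by apply: (can_inj fK); rewrite linear0; apply: free; rewrite -fM xx.
Qed.

(** Allowing [e = 0] treats the cases E = 0 and E = Fe uniformly. *)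
Definition idempotent_generator (F : fieldType) (P : poissonType F)
    (E : submodClosed P) (e : P) : Prop :=
  pmul e e = e /\ forall x, x \in E <-> exists a : F, x = a *: e.

Lemma idempotent_generator_exists (F : fieldType) (P : poissonType F)
    (E : submodClosed P) :
  zero_or_idempotent_line E -> exists e, idempotent_generator E e.
Proof.
case=> [E0|[e [_ ee eE]]]; last by exists e.
exists 0; split; first by rewrite linear0r.
by move=> x; rewrite E0; split=> [->|[a ->]]; [exists 0|]; rewrite scaler0.
Qed.

Lemma idempotent_generator_mem (F : fieldType) (P : poissonType F)
    (E : submodClosed P) (e : P) a :
  idempotent_generator E e -> a *: e \in E.
Proof. by case=> _ eE; apply/eE; exists a. Qed.

Lemma zero_idempotent_generator (F : fieldType) (P : poissonType F)
    (E : submodClosed P) (e : P) :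
  idempotent_generator E e -> is_zero_subspace E <-> e = 0.
Proof.
case=> _ eE; split=> [E0|e0 x].
  by apply/E0/eE; exists 1; rewrite scale1r.
by rewrite eE e0; split=> [[a ->]|->]; [rewrite scaler0 | exists 0; rewrite scaler0].
Qed.

(** When [e = 0] the coordinate of an element along [e] is not unique; this is
    what makes [a *: e |-> a *: e'] well defined nonetheless. *)
Lemma scale_generator_eq0 (F : fieldType) (U U' : lmodType F) (e : U) (e' : U')
    (a : F) :
  (e = 0 <-> e' = 0) -> a *: e = 0 -> a *: e' = 0.
Proof.
move=> ee' /eqP; rewrite scaler_eq0 => /orP[/eqP->|/eqP/ee'->].
  by rewrite scale0r.
by rewrite scaler0.
Qed.

(** * Structure of type (I) algebras *)

Section TypeI.
Context (F : fieldType) (P : poissonType F) (E Z : submodClosed P) (e : P).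
Context (PI : typeI E Z) (eE : idempotent_generator E e).

Lemma typeI_decomposition (x : P) :
  exists (a : F) (z : subspace Z), x = a *: e + val z.
Proof.
have [y [z [/(proj2 eE)[a ->] zZ ->]]] := typeI_sum PI x.
by exists a, (Subspace zZ).
Qed.

Lemma typeI_coordinates0 (a : F) (z : subspace Z) :
  a *: e + val z = 0 -> a *: e = 0 /\ z = 0.
Proof.
case/(typeI_direct PI); rewrite ?subspace_valP ?(idempotent_generator_mem a eE) //.
by move=> -> z0; split=> //; apply: val_inj; rewrite z0 linear0.
Qed.

Lemma typeI_pmul (a b : F) (z w : subspace Z) :
  pmul (a *: e + val z) (b *: e + val w) = (a * b) *: e.
Proof.
have eZ (u : subspace Z) : pmul e (val u) = 0.
  by rewrite (typeI_mulEZ PI) ?subspace_valP // -[e]scale1r; apply: idempotent_generator_mem.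
rewrite linearDl !linearDr !linearZl_LR !linearZr_LR /= [pmul (val z) e]pmulC.
by rewrite !eZ (typeI_mulZZ PI (subspace_valP z) (subspace_valP w)) (proj1 eE) !scaler0 !addr0 scalerA.
Qed.

(** Multiplying by [e] detects the E-component, so nothing outside Z is
    killed by all of P. *)
Lemma typeI_annihilator (x : P) :
  annihilator x <-> exists z : subspace Z, x = val z.
Proof.
split=> [annx|[z ->] y].
  have [a [z xE]] := typeI_decomposition x.
  exists z; rewrite xE.
  have [+ _] := annx (1 *: e + val (0 : subspace Z)).
  by rewrite xE typeI_pmul mulr1 => ->; rewrite add0r.
split; last exact: typeI_br PI _ _.
have [b [w ->]] := typeI_decomposition y.
by rewrite -[val z]add0r -(scale0r e) typeI_pmul mul0r scale0r.
Qed.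

Lemma typeI_idempotent_free : is_zero_subspace E <-> idempotent_free P.
Proof.
rewrite (zero_idempotent_generator eE); split=> [e0 x|]; last first.
  by apply; exact: (proj1 eE).
by have [a [z ->]] := typeI_decomposition x; rewrite typeI_pmul e0 !scaler0.
Qed.

End TypeI.

(** * Structure of type (II) algebras *)

Section TypeII.
Context (F : fieldType) (P : poissonType F) (E Z V : submodClosed P) (c e : P).
Context (beta omega : {biscalar (subspace V)}).
Context (PII : typeII E Z c beta omega) (eE : idempotent_generator E e).

Lemma typeII_decomposition (x : P) :
  exists (a : F) (z : subspace Z) (v : subspace V) (t : F),
    x = a *: e + val z + val v + t *: c.
Proof.
have [y [z [v [t [/(proj2 eE)[a ->] zZ vV ->]]]]] := typeII_sum PII x.
by exists a, (Subspace zZ), (Subspace vV), t.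
Qed.

Lemma typeII_coordinates0 (a : F) (z : subspace Z) (v : subspace V) (t : F) :
    a *: e + val z + val v + t *: c = 0 ->
  [/\ a *: e = 0, z = 0, v = 0 & t = 0].
Proof.
case/(typeII_direct PII); rewrite ?subspace_valP ?(idempotent_generator_mem a eE) //.
move=> -> z0 v0 /eqP; rewrite scaler_eq0 (negbTE (typeII_c PII)) orbF => /eqP->.
by split=> //; apply: val_inj; rewrite ?z0 ?v0 linear0.
Qed.

(** Z and c annihilate everything, so only the components in E and V
    matter. *)
Lemma typeII_operations (a b : F) (z w : subspace Z) (v u : subspace V)
    (t s : F) :
  let x := a *: e + val z + val v + t *: c in
  let y := b *: e + val w + val u + s *: c in
  pmul x y = (a * b) *: e + beta v u *: c /\ pbr x y = omega v u *: c.
Proof.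
have e1 : e \in E by rewrite -[e]scale1r; apply: idempotent_generator_mem.
have annz (z1 : subspace Z) : annihilator (val z1).
  by move=> y; rewrite (typeII_mulZ PII) ?(typeII_brZ PII) ?subspace_valP.
have annc (r : F) : annihilator (r *: c).
  by move=> y; rewrite !linearZl_LR /= (typeII_mulc PII) (typeII_brc PII) scaler0.
have annzc (z1 : subspace Z) (v1 : subspace V) (r r1 : F) :
    annihilator (r *: e + val z1 + val v1 + r1 *: c - (r *: e + val v1)).
  move=> y; rewrite -(addrA _ (val v1)) addrACA [_ - _]addrC addKr.
  by rewrite !linearDl; have [-> ->] := annz z1 y; have [-> ->] := annc r1 y; rewrite !addr0.
move=> x y; rewrite {}/x {}/y.
have [-> ->] := operations_mod_annihilator (annzc z v a t) (annzc w u b s).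
have br0 r y : pbr (r *: e) y = 0.
  by rewrite linearZl_LR /= (typeII_brE PII) // scaler0.
have eV (v1 : subspace V) : pmul e (val v1) = 0.
  by rewrite (typeII_mulEV PII) ?subspace_valP.
rewrite !linearDl !linearDr !br0 [pbr (val v) (b *: e)]pbr_anti br0 oppr0 !add0r.
rewrite (typeII_brVV PII) (typeII_mulVV PII); split=> //.
rewrite !linearZl_LR !linearZr_LR /= [pmul (val v) e]pmulC !eV (proj1 eE).
by rewrite !scaler0 addr0 add0r scalerA.
Qed.

(** If x has components [a *: e] and [v], then
    x^2 = a^2 e + beta(v,v) c; when this vanishes, so do [a *: e] and, by
    anisotropy, [v]. *)
Lemma typeII_annihilator (x : P) :
  annihilator x <-> exists (z : subspace Z) (t : F), x = val z + t *: c.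
Proof.
split=> [annx|[z [t ->]] y]; last first.
  rewrite !linearDl !linearZl_LR /= (typeII_mulc PII) (typeII_brc PII).
  by rewrite (typeII_mulZ PII) ?(typeII_brZ PII) ?subspace_valP // scaler0 addr0.
have [a [z [v [t xE]]]] := typeII_decomposition x.
have [+ _] := annx x; rewrite {1 2}xE.
have [-> _] := typeII_operations a a z z v v t t => xx0.
have := @typeII_coordinates0 (a * a) 0 0 (beta v v).
rewrite !linear0 !addr0 => /(_ xx0)[].
move=> /eqP; rewrite scaler_eq0 mulf_eq0 orbb -scaler_eq0 => /eqP ae _ _ bvv.
have v0 : v = 0.
  by apply: contrapT => /eqP /(typeII_beta_aniso PII); rewrite bvv eqxx.
by exists z, t; rewrite xE ae v0 linear0 add0r addr0.
Qed.

(** With the next lemma this describes V + Ann intrinsically, as the set of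
    elements whose square lies in the annihilator: the square is
    a^2 e + beta(v,v) c, and multiplying it by [e] isolates a^2 e. *)
Lemma typeII_square_annihilator (x : P) :
    annihilator (pmul x x) ->
  exists v : subspace V, annihilator (x - val v).
Proof.
have [a [z [v [t ->]]]] := typeII_decomposition x.
have [-> _] := typeII_operations a a z z v v t t => annxx.
exists v.
have [+ _] := annxx e.
rewrite linearDl !linearZl_LR /= (proj1 eE) (typeII_mulc PII) scaler0 addr0.
move=> /eqP; rewrite scaler_eq0 mulf_eq0 orbb -scaler_eq0 => /eqP->.
by rewrite add0r addrAC addrK; apply/typeII_annihilator; exists z, t.
Qed.

Lemma typeII_annihilatorVV (v : subspace V) :
  annihilator (pmul (val v) (val v)).
Proof.
rewrite (typeII_mulVV PII); apply/typeII_annihilator.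
by exists 0, (beta v v); rewrite linear0 add0r.
Qed.

Lemma typeII_annihilatorV0 (v : subspace V) : annihilator (val v) -> v = 0.
Proof.
move=> annv; apply: contrapT => /eqP v0; have [+ _] := annv (val v).
move/eqP; rewrite (typeII_mulVV PII) scaler_eq0 (negbTE (typeII_c PII)) orbF.
by rewrite (negbTE (typeII_beta_aniso PII v0)).
Qed.

Lemma typeII_idempotent_free : is_zero_subspace E <-> idempotent_free P.
Proof.
rewrite (zero_idempotent_generator eE); split=> [e0 x|]; last first.
  by apply; exact: (proj1 eE).
have [a [z [v [t xE]]]] := typeII_decomposition x; move=> xx.
have x2 : x = beta v v *: c.
  have [+ _] := typeII_operations a a z z v v t t.
  by rewrite -xE xx => ->; rewrite e0 scaler0 add0r.
by rewrite -xx {1}x2 linearZl_LR /= (typeII_mulc PII) scaler0.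
Qed.

End TypeII.

(** * Classification of type (I) *)

Lemma idempotent_generators_vanish (F : fieldType) (P P' : poissonType F)
    (E : submodClosed P) (E' : submodClosed P') (e : P) (e' : P') :
    idempotent_generator E e -> idempotent_generator E' e' ->
    (is_zero_subspace E <-> is_zero_subspace E') ->
  e = 0 <-> e' = 0.
Proof. by move=> /zero_idempotent_generator-> /zero_idempotent_generator->. Qed.

(** Z is the annihilator, and E vanishes exactly when 0 is the only
    idempotent. *)
Lemma typeI_isomorphic_invariants (F : fieldType) (P P' : poissonType F)
    (E Z : submodClosed P) (E' Z' : submodClosed P') :
    typeI E Z -> typeI E' Z' -> poisson_isomorphic P P' ->
  (is_zero_subspace E <-> is_zero_subspace E') /\
  same_dim (subspace Z) (subspace Z').
Proof.
move=> PI PI' [f [fbij fM fB]].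
have [e eE] := idempotent_generator_exists (typeI_E PI).
have [e' eE'] := idempotent_generator_exists (typeI_E PI').
split.
  rewrite (typeI_idempotent_free PI eE) (typeI_idempotent_free PI' eE').
  exact: isomorphism_idempotent_free fbij fM.
have fann := isomorphism_annihilator fbij fM fB.
have [g fK gK] := fbij.
have [|||||h [hbij _]] := @linear_bijection_of_graph F (subspace Z) (subspace Z')
  (fun z z' => f (val z) = val z').
- by move=> a z z' w w' fz fw; rewrite !linearP fz fw.
- move=> z; apply/(typeI_annihilator PI' eE')/fann.
  by apply/(typeI_annihilator PI eE); exists z.
- move=> z'; have [|z gz] := proj1 (typeI_annihilator PI eE (g (val z'))).
    by apply/fann; rewrite gK; apply/(typeI_annihilator PI' eE'); exists z'.
  by exists z; rewrite -gz gK.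
- by move=> z' z'0; apply: val_inj; rewrite -z'0 !linear0.
- by move=> z fz0; apply: val_inj; apply: (can_inj fK); rewrite fz0 !linear0.
exact: linear_bijection_same_dim hbij.
Qed.

Lemma typeI_isomorphic_of_invariants (F : fieldType) (P P' : poissonType F)
    (E Z : submodClosed P) (E' Z' : submodClosed P') :
    typeI E Z -> typeI E' Z' ->
    (is_zero_subspace E <-> is_zero_subspace E') ->
    same_dim (subspace Z) (subspace Z') ->
  poisson_isomorphic P P'.
Proof.
move=> PI PI' EE' /same_dim_linear_bijection[h [k hK kK]].
have [e eE] := idempotent_generator_exists (typeI_E PI).
have [e' eE'] := idempotent_generator_exists (typeI_E PI').
have ee' := idempotent_generators_vanish eE eE' EE'.
apply: (@poisson_isomorphic_of_graph F P P' (fun x x' =>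
  exists (a : F) (z : subspace Z),
    x = a *: e + val z /\ x' = a *: e' + val (h z))).
- move=> b _ _ _ _ [a [z [-> ->]]] [a1 [z1 [-> ->]]].
  exists (b * a + a1), (b *: z + z1).
  rewrite [h (_ + _)]linearP ![val (_ *: _ + _)]linearP.
  by rewrite !scalerDr !scalerDl !scalerA; split; rewrite addrACA.
- move=> x; have [a [z ->]] := typeI_decomposition PI eE x.
  by exists (a *: e' + val (h z)), a, z.
- move=> x'; have [a [z' ->]] := typeI_decomposition PI' eE' x'.
  by exists (a *: e + val (k z')), a, (k z'); rewrite kK.
- move=> _ [a [z [/esym/(typeI_coordinates0 PI eE)[ae ->] ->]]].
  by rewrite (scale_generator_eq0 ee' ae) !linear0 add0r.
- move=> _ [a [z [-> /esym/(typeI_coordinates0 PI' eE')[ae hz]]]].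
  rewrite (scale_generator_eq0 (iff_sym ee') ae).
  by rewrite (_ : z = 0) ?linear0 ?add0r //; apply: (can_inj hK); rewrite hz linear0.
- move=> _ _ _ _ [a [z [-> ->]]] [b [w [-> ->]]]; split.
    exists (a * b), 0.
    by rewrite (typeI_pmul PI eE) (typeI_pmul PI' eE') !linear0 !addr0.
  exists 0, 0.
  by rewrite (typeI_br PI) (typeI_br PI') !linear0 !scale0r !addr0.
Qed.

(** * Classification of type (II) *)

(** Squares of elements of V lie in the annihilator, hence so do squares of
    their images, and this characterizes V' up to the annihilator. *)
Lemma typeII_isomorphism_mod_annihilator (F : fieldType) (P P' : poissonType F)
    (E Z V : submodClosed P) (c : P) (beta omega : {biscalar (subspace V)})
    (E' Z' V' : submodClosed P') (c' : P')
    (beta' omega' : {biscalar (subspace V')}) (f : {linear P -> P'}) :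
    typeII E Z c beta omega -> typeII E' Z' c' beta' omega' ->
    bijective f -> (forall x y, f (pmul x y) = pmul (f x) (f y)) ->
    (forall x y, f (pbr x y) = pbr (f x) (f y)) ->
  forall v : subspace V, exists v' : subspace V',
    annihilator (f (val v) - val v').
Proof.
move=> PII PII' fbij fM fB v.
have [e eE] := idempotent_generator_exists (typeII_E PII).
have [e' eE'] := idempotent_generator_exists (typeII_E PII').
have fann := isomorphism_annihilator fbij fM fB.
apply: (typeII_square_annihilator PII' eE').
by rewrite -fM; apply/fann/(typeII_annihilatorVV PII eE).
Qed.

(** Since V is nonzero and beta is anisotropic, [c] is a multiple of a square
    v^2 with v in V; modulo the annihilator f v lies in V', so its square is a
    multiple of [c']. *)
Lemma typeII_isomorphism_line (F : fieldType) (P P' : poissonType F)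
    (E Z V : submodClosed P) (c : P) (beta omega : {biscalar (subspace V)})
    (E' Z' V' : submodClosed P') (c' : P')
    (beta' omega' : {biscalar (subspace V')}) (f : {linear P -> P'}) :
    typeII E Z c beta omega -> typeII E' Z' c' beta' omega' ->
    bijective f -> (forall x y, f (pmul x y) = pmul (f x) (f y)) ->
    (forall x y, f (pbr x y) = pbr (f x) (f y)) ->
  exists2 lambda, lambda != 0 & f c = lambda *: c'.
Proof.
move=> PII PII' fbij fM fB.
have [v v0] : exists v : subspace V, v != 0.
  apply: contrapT => noV; apply: (typeII_V PII) => x; split=> [xV|->].
    have [v0|v0] := eqVneq (Subspace xV) 0; last first.
      by case: noV; exists (Subspace xV).
    by have := congr1 val v0; rewrite linear0.
  by have := subspace_valP (0 : subspace V); rewrite linear0.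
have [v' annv'] :=
  typeII_isomorphism_mod_annihilator PII PII' fbij fM fB v.
have bvv := typeII_beta_aniso PII v0.
have fc : f c = ((beta v v)^-1 * beta' v' v') *: c'.
  rewrite -[c in LHS](scalerK bvv) -(typeII_mulVV PII) linearZ /= fM.
  have [-> _] := operations_mod_annihilator annv' annv'.
  by rewrite (typeII_mulVV PII') scalerA.
exists ((beta v v)^-1 * beta' v' v') => //.
apply: contra_neq (typeII_c PII) => l0; apply: (bij_inj fbij).
by rewrite fc l0 scale0r linear0.
Qed.

(** Z is recovered as Ann / Fc and V as (V + Ann) / Ann; the graphs below
    relate representatives modulo Fc' and modulo Ann'. *)
Lemma typeII_isomorphic_invariants (F : fieldType) (P P' : poissonType F)
    (E Z V : submodClosed P) (c : P) (beta omega : {biscalar (subspace V)})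
    (E' Z' V' : submodClosed P') (c' : P')
    (beta' omega' : {biscalar (subspace V')}) :
    typeII E Z c beta omega -> typeII E' Z' c' beta' omega' ->
    poisson_isomorphic P P' ->
  [/\ is_zero_subspace E <-> is_zero_subspace E',
      same_dim (subspace Z) (subspace Z')
    & simultaneously_similar beta omega beta' omega'].
Proof.
move=> PII PII' [f [fbij fM fB]].
have [e eE] := idempotent_generator_exists (typeII_E PII).
have [e' eE'] := idempotent_generator_exists (typeII_E PII').
have fann := isomorphism_annihilator fbij fM fB.
have totl := typeII_isomorphism_mod_annihilator PII PII' fbij fM fB.
have [lambda l0 fc] := typeII_isomorphism_line PII PII' fbij fM fB.
have [g fK gK] := fbij.
have c'E : c' = f (lambda^-1 *: c) by rewrite linearZ /= fc scalerK.
split.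
- rewrite (typeII_idempotent_free PII eE) (typeII_idempotent_free PII' eE').
  exact: isomorphism_idempotent_free fbij fM.
- have [|||||h [hbij _]] := @linear_bijection_of_graph F (subspace Z)
    (subspace Z') (fun z z' => exists t, f (val z) = val z' + t *: c').
  + move=> a z z' w w' [t fz] [s fw]; exists (a * t + s).
    by rewrite !linearP fz fw scalerDr scalerDl scalerA addrACA.
  + move=> z; apply/(typeII_annihilator PII' eE')/fann.
    by apply/(typeII_annihilator PII eE); exists z, 0; rewrite scale0r addr0.
  + move=> z'.
    have [|z [t gz]] := proj1 (typeII_annihilator PII eE (g (val z'))).
      apply/fann; rewrite gK; apply/(typeII_annihilator PII' eE').
      by exists z', 0; rewrite scale0r addr0.
    (* g z' = z + t c gives z' = f z + t lambda c'. *)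
    exists z, (- (t * lambda)).
    by rewrite -[val z'](gK) gz linearD linearZ /= fc scalerA scaleNr addrK.
  + move=> z' [t]; rewrite !linear0 => /esym zt.
    have [|_ -> //] := @typeII_coordinates0 _ _ _ _ _ _ _ _ _ PII' eE' 0 z' 0 t.
    by rewrite scale0r linear0 add0r addr0.
  + move=> z [t]; rewrite linear0 add0r c'E -linearZ => /(can_inj fK) zt.
    have [|_ -> //] := @typeII_coordinates0 _ _ _ _ _ _ _ _ _ PII eE 0 z 0
                         (- (t * lambda^-1)).
    by rewrite scale0r linear0 add0r addr0 zt scalerA scaleNr subrr.
  exact: linear_bijection_same_dim hbij.
- have [|||||phi [phibij phiE]] := @linear_bijection_of_graph F (subspace V)
    (subspace V') (fun v v' => annihilator (f (val v) - val v')).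
  + move=> a v v' w w' annv annw y.
    rewrite ![val (_ *: _ + _)]linearP [f (_ + _)]linearP opprD addrACA -scalerBr.
    rewrite !linearPl.
    by have [-> ->] := annv y; have [-> ->] := annw y; rewrite scaler0 addr0.
  + exact: totl.
  + move=> v'; have [|v annv] := typeII_square_annihilator PII eE (x := g (val v')).
      by apply/fann; rewrite fM gK; apply: typeII_annihilatorVV PII' eE' _.
    exists v => y; have := proj2 (fann _) annv (- y).
    by rewrite linearB /= gK !linearNr -!linearNl opprB.
  + move=> v' annv'; apply: (typeII_annihilatorV0 PII') => y.
    have := annv' (- y).
    by rewrite !linear0 sub0r !linearNr !linearNl !opprK.
  + move=> v annv; apply/(typeII_annihilatorV0 PII)/fann.
    by move: annv; rewrite [val 0]linear0 subr0.
  have annphi v : annihilator (f (val v) - val (phi v)) by apply/phiE.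
  have c'inj : injective (fun t => t *: c').
    move=> t s /eqP; rewrite -subr_eq0 -scalerBl scaler_eq0.
    by rewrite (negbTE (typeII_c PII')) orbF subr_eq0 => /eqP.
  exists phi, lambda; split=> // u v; apply: c'inj => /=;
    have [mulE brE] := operations_mod_annihilator (annphi u) (annphi v).
    by rewrite -(typeII_mulVV PII') -mulE -fM (typeII_mulVV PII) linearZ /=
               fc scalerA mulrC.
  by rewrite -(typeII_brVV PII') -brE -fB (typeII_brVV PII) linearZ /=
             fc scalerA mulrC.
Qed.

(** The isomorphism is e |-> e', [h] on Z, [phi] on V and c |-> lambda c'; the
    last scalar is forced by the similarity factor. *)
Lemma typeII_isomorphic_of_invariants (F : fieldType) (P P' : poissonType F)
    (E Z V : submodClosed P) (c : P) (beta omega : {biscalar (subspace V)})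
    (E' Z' V' : submodClosed P') (c' : P')
    (beta' omega' : {biscalar (subspace V')}) :
    typeII E Z c beta omega -> typeII E' Z' c' beta' omega' ->
    (is_zero_subspace E <-> is_zero_subspace E') ->
    same_dim (subspace Z) (subspace Z') ->
    simultaneously_similar beta omega beta' omega' ->
  poisson_isomorphic P P'.
Proof.
move=> PII PII' EE' /same_dim_linear_bijection[h [k hK kK]].
move=> [phi [lambda [[psi phiK psiK] l0 betaE omegaE]]].
have [e eE] := idempotent_generator_exists (typeII_E PII).
have [e' eE'] := idempotent_generator_exists (typeII_E PII').
have ee' := idempotent_generators_vanish eE eE' EE'.
have linear4 (U U1 U2 : lmodType F) (i : {linear U1 -> U}) (j : {linear U2 -> U})
    (d b : U) r a x y t a1 x1 y1 t1 :
    r *: (a *: d + i x + j y + t *: b) + (a1 *: d + i x1 + j y1 + t1 *: b) =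
    (r * a + a1) *: d + i (r *: x + x1) + j (r *: y + y1) + (r * t + t1) *: b.
  rewrite [i (_ + _)]linearP [j (_ + _)]linearP !scalerDr !scalerA !scalerDl.
  by rewrite addrACA; congr (_ + _); rewrite addrACA; congr (_ + _); rewrite addrACA.
apply: (@poisson_isomorphic_of_graph F P P' (fun x x' =>
  exists (a : F) (z : subspace Z) (v : subspace V) (t : F),
    x = a *: e + val z + val v + t *: c /\
    x' = a *: e' + val (h z) + val (phi v) + (t * lambda) *: c')).
- move=> b _ _ _ _ [a [z [v [t [-> ->]]]]] [a1 [z1 [v1 [t1 [-> ->]]]]].
  exists (b * a + a1), (b *: z + z1), (b *: v + v1), (b * t + t1).
  by rewrite !linear4 [h (_ + _)]linearP [phi (_ + _)]linearP mulrDl mulrA.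
- move=> x; have [a [z [v [t ->]]]] := typeII_decomposition PII eE x.
  by exists (a *: e' + val (h z) + val (phi v) + (t * lambda) *: c'), a, z, v, t.
- move=> x'; have [a [z' [v' [t ->]]]] := typeII_decomposition PII' eE' x'.
  exists (a *: e + val (k z') + val (psi v') + (t / lambda) *: c).
  by exists a, (k z'), (psi v'), (t / lambda); rewrite kK psiK divfK.
- move=> _ [a [z [v [t [/esym/(typeII_coordinates0 PII eE)[ae -> -> ->] ->]]]]].
  by rewrite (scale_generator_eq0 ee' ae) !linear0 mul0r scale0r !add0r.
- move=> _ [a [z [v [t [-> /esym/(typeII_coordinates0 PII' eE')]]]]] [ae hz pv tl].
  have z0 : z = 0 by apply: (can_inj hK); rewrite hz linear0.
  have v0 : v = 0 by apply: (can_inj phiK); rewrite pv linear0.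
  have t0 : t = 0 by rewrite -[t](mulfK l0) tl mul0r.
  rewrite (scale_generator_eq0 (iff_sym ee') ae) z0 v0 t0.
  by rewrite !linear0 scale0r !add0r.
- move=> _ _ _ _ [a [z [v [t [-> ->]]]]] [b [w [u [s [-> ->]]]]].
  have [-> ->] := typeII_operations PII eE a b z w v u t s.
  have [-> ->] := typeII_operations PII' eE' a b (h z) (h w) (phi v) (phi u)
                    (t * lambda) (s * lambda).
  rewrite betaE omegaE ![lambda * _]mulrC; split.
    by exists (a * b), 0, 0, (beta v u); rewrite !linear0 !addr0.
  by exists 0, 0, 0, (omega v u); rewrite !linear0 !scale0r !add0r.
Qed.

(** * The theorem *)

Theorem theorem7p1 (F : fieldType) (P P' : poissonType F)
    (dedP : dedekind P) (dedP' : dedekind P') :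
  (forall (E Z : submodClosed P) (E' Z' : submodClosed P'),
     typeI E Z -> typeI E' Z' ->
     (poisson_isomorphic P P' <->
      ((is_zero_subspace E <-> is_zero_subspace E') /\
       same_dim (subspace Z) (subspace Z'))))
  /\
  (forall (E Z V : submodClosed P) (c : P)
          (beta omega : {biscalar (subspace V)}%R)
          (E' Z' V' : submodClosed P') (c' : P')
          (beta' omega' : {biscalar (subspace V')}%R),
     typeII E Z c beta omega -> typeII E' Z' c' beta' omega' ->
     (poisson_isomorphic P P' <->
      [/\ is_zero_subspace E <-> is_zero_subspace E',
          same_dim (subspace Z) (subspace Z')
        & simultaneously_similar beta omega beta' omega'])).
Proof.
split=> [E Z E' Z' PI PI'|E Z V c beta omega E' Z' V' c' beta' omega' PII PII'].
  split=> [|[EE' ZZ']]; first exact: typeI_isomorphic_invariants PI PI'.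
  exact: typeI_isomorphic_of_invariants PI PI' EE' ZZ'.
split=> [|[EE' ZZ' sim]]; first exact: typeII_isomorphic_invariants PII PII'.
exact: typeII_isomorphic_of_invariants PII PII' EE' ZZ' sim.
Qed.
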